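(* Let $F$ be a field of characteristic $\neq 2$, let $V$ be a finite dimensional vector space over $F$, and let $Q$ be a nondegenerate symmetric bilinear form on $V$. The bilinear form $\overline{Q}$ on $C\ell(V,Q)$ satisfies: 1) $\overline{Q}(1,1) = 1$. 2) $L(x)^{*} = L(c(x))$ for all $x \in C\ell(V,Q)$. 3) $R(x)^{*} = R(c(x))$ for all $x \in C\ell(V,Q)$. 4) $\overline{Q} = Q$ on $V$. 5) $\overline{Q}(\alpha(x), \alpha(y)) = \overline{Q}(x,y)$ for all $x,y \in C\ell(V,Q)$. 6) $\overline{Q}(c(x), c(y)) = \overline{Q}(x,y)$ for all $x,y \in C\ell(V,Q)$.
   Context: $C\ell(V,Q)$ is the Clifford algebra: the universal associative unital $F$-algebra containing $V$ in which $v\cdot v = -Q(v,v)1$ for all $v\in V$. $\alpha$ is the unique algebra automorphism, and $c$ the unique algebra anti-automorphism, of $C\ell(V,Q)$ with $\alpha(v)=c(v)=-v$ for all $v\in V$. If $\{e_1,\dots,e_n\}$ is a $Q$-orthogonal basis of $V$, then $1$ together with the products $e_{i_1}\cdots e_{i_k}$ ($k\ge1$, $i_1<\dots<i_k$) is a basis of $C\ell(V,Q)$; $p(x)\in F$ denotes the coefficient of $1$ in $x$ (independent of the orthogonal basis), and $\overline{Q}(x,y) = p(x\cdot c(y))$, which is a nondegenerate symmetric bilinear form on $C\ell(V,Q)$. $L(x)$ and $R(x)$ are left and right multiplication by $x$ on $C\ell(V,Q)$. For a linear map $T$ of $C\ell(V,Q)$, $T^*$ is the metric adjoint: the unique linear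 map with $\overline{Q}(Ty,z)=\overline{Q}(y,T^*z)$ for all $y,z$. *)

(* Defs.v *)
From HB Require Import structures.
From mathcomp Require Import all_boot all_order all_algebra.
From mathcomp Require Import boolp classical_sets.

Set Implicit Arguments.
Unset Strict Implicit.
Unset Printing Implicit Defensive.

Import GRing.Theory.
Local Open Scope ring_scope.

Section Clifford.
Variables (F : fieldType) (V : vectType F) (Q : {symmetric V}).

Section Maps.
Variables (C : algType F) (iota : {linear V -> C}).

Definition clifford_relation (A : algType F) (f : V -> A) : Prop :=
  forall v, f v * f v = - (Q v v)%:A.

(* An [algType] is a nonzero ring. Leaving the zero ring out of the test
   algebras costs nothing, since every map to it is the same. *)
Definition clifford_universal : Prop :=
  forall (A : algType F) (f : {linear V -> A}), clifford_relation f ->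
    exists g : {lrmorphism C -> A},
      (forall v, g (iota v) = f v) /\
      (forall g' : {lrmorphism C -> A},
         (forall v, g' (iota v) = f v) -> g' =1 g).

Definition is_clifford_algebra : Prop :=
  [/\ injective iota, clifford_relation iota & clifford_universal].

Definition is_algebra_automorphism (f : C -> C) : Prop :=
  [/\ linear f, bijective f, f 1 = 1 & forall x y, f (x * y) = f x * f y].

Definition is_algebra_antiautomorphism (f : C -> C) : Prop :=
  [/\ linear f, bijective f, f 1 = 1 & forall x y, f (x * y) = f y * f x].

(* The maps alpha and c, the scalar part and the adjoint are characterized as
   the unique objects with some property; [xget] selects such an object, and
   its first argument is the junk value returned when there is none. *)
Definition clifford_alpha : C -> C :=
  xget (fun=> 0) [set f : C -> C | is_algebra_automorphism f /\
                                   forall v, f (iota v) = - iota v]%classic.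

Definition clifford_conj : C -> C :=
  xget (fun=> 0) [set f : C -> C | is_algebra_antiautomorphism f /\
                                   forall v, f (iota v) = - iota v]%classic.

Definition orthogonal_basis (e : (\dim {:V}).-tuple V) : bool :=
  basis_of {:V} e && pairwise_orthogonal Q e.

(* The big product enumerates ['I_n] increasingly, so this is
   e_{i_1} ... e_{i_k} with i_1 < ... < i_k the elements of I, and 1 when I
   is empty. *)
Definition basis_product n (e : n.-tuple V) (I : {set 'I_n}) : C :=
  \prod_(i in I) iota (tnth e i).

Definition scalar_part (x : C) : F :=
  xget 0 [set t : F | exists (e : (\dim {:V}).-tuple V)
                             (a : {set 'I_(\dim {:V})} -> F),
            [/\ orthogonal_basis e,
                x = \sum_(I : {set 'I_(\dim {:V})}) a I *: basis_product e I
              & t = a finset.set0]]%classic.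

Definition Qbar (x y : C) : F := scalar_part (x * clifford_conj y).

End Maps.
End Clifford.

Definition metric_adjoint (F : fieldType) (C : algType F) (B : C -> C -> F)
    (T : C -> C) : C -> C :=
  xget (fun=> 0) [set S : C -> C | linear S /\
                    forall y z, B (T y) z = B y (S z)]%classic.

Definition Lmul (F : fieldType) (C : algType F) (x : C) : C -> C :=
  fun y => x * y.

Definition Rmul (F : fieldType) (C : algType F) (x : C) : C -> C :=
  fun y => y * x.

(* Main.v *)
(** The coefficient of 1 is a normalized trace: it is the only linear form tau
    on the Clifford algebra with tau(1) = 1, tau(alpha(x)) = tau(x) and
    tau(xy) = tau(yx). Indeed, for a nonempty set I of indices, the product e_I
    of vectors of an orthogonal basis either anticommutes with some e_k or is
    odd under alpha, and any such tau vanishes on it. By uniqueness tau is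
    independent of the basis and invariant under c, so all six identities become
    manipulations of traces. The same sign argument applied to e_I^-1 e_J shows
    that (x, y) |-> tau(xy) is nondegenerate, which makes adjoints unique.
    No model of the Clifford algebra is needed to construct tau: 1 is independent
    of the other e_I because each of these has a nontrivial sign under the
    commutation with some e_k or under alpha. *)

Require Import Defs.
From HB Require Import structures.
From mathcomp Require Import all_boot all_order all_algebra.
From mathcomp Require Import boolp.
From mathcomp Require classical_sets.

Set Implicit Arguments.
Unset Strict Implicit.
Unset Printing Implicit Defensive.

Import GRing.Theory.
Local Open Scope ring_scope.

(** * Opposite algebras and subalgebras *)

(* The converse ring [A^c] has no module structure of its own: used as an
   algebra, it unfolds to [A] and silently gets back the product of [A]. *)
Definition opposite (A : Type) : Type := A.

Section Opposite.
Variables (F : fieldType) (A : algType F).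

HB.instance Definition _ := GRing.Lmodule.copy (opposite A) A.
HB.instance Definition _ := GRing.Nmodule_isNzSemiRing.Build (opposite A)
  (fun x y z : A => esym (mulrA z y x)) (@mulr1 A) (@mul1r A)
  (fun x y z : A => mulrDr z x y) (fun x y z : A => mulrDl y z x)
  (@mulr0 A) (@mul0r A) (oner_neq0 A).

Fact opposite_scalerAl (a : F) (u v : opposite A) :
  a *: (u * v) = (a *: u : opposite A) * v.
Proof. exact: (@scalerAr F A a v u). Qed.

HB.instance Definition _ :=
  GRing.Lmodule_isLalgebra.Build F (opposite A) opposite_scalerAl.

Fact opposite_scalerAr (a : F) (u v : opposite A) :
  a *: (u * v) = u * (a *: v : opposite A).
Proof. exact: (@scalerAl F A a v u). Qed.

HB.instance Definition _ :=
  GRing.Lalgebra_isAlgebra.Build F (opposite A) opposite_scalerAr.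

End Opposite.

(** The closure proof is a parameter of the type so that the algebra structure can be inferred from
    the type alone. *)
Definition subalgebra (F : fieldType) (A : algType F) (P : {pred A})
  of subalg_closed P : Type := {x : A | x \in P}.

Section Subalgebra.
Variables (F : fieldType) (A : algType F) (P : {pred A}).
Variable clP : subalg_closed P.

HB.instance Definition _ := SubChoice.on (subalgebra clP).
HB.instance Definition _ := GRing.SubChoice_isSubAlgebra.Build F A
  (fun x => x \in P) (subalgebra clP) (GRing.subalg_closed_semi clP).

End Subalgebra.

(** * Consequences of the universal property: induction, [alpha] and [c] *)

Section UniversalProperty.
Variables (F : fieldType) (V : vectType F) (Q : {symmetric V}).
Variables (C : algType F) (iota : {linear V -> C}).
Hypothesis clC : is_clifford_algebra Q iota.

(** Both [g] and the identity extend [iota], and such an extension is unique. *)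
Lemma clifford_endo_id (g : {lrmorphism C -> C}) :
  (forall v, g (iota v) = iota v) -> g =1 id.
Proof.
move=> gE x; case: clC => _ relC univ.
have [h [_ hU]] := univ C iota relC.
by rewrite (hU g gE) -(hU idfun).
Qed.

(* The elements satisfying [P] form a subalgebra; the map into it given by the
   universal property is, after inclusion, the identity of [C]. *)
Lemma clifford_ind (P : C -> Prop) :
  P 1 -> (forall v, P (iota v)) ->
  (forall (a : F) x y, P x -> P y -> P (a *: x + y)) ->
  (forall x y, P x -> P y -> P (x * y)) -> forall x, P x.
Proof.
move=> P1 Piota PL PM x.
pose S : {pred C} := fun x => `[< P x >].
have SP y : reflect (P y) (y \in S) by exact: asboolP.
have clS : subalg_closed S.
  split; first exact/SP.
  - move=> a u v /SP Pu /SP Pv. exact/SP/PL.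
  - move=> u v /SP Pu /SP Pv. exact/SP/PM.
have Siota v : iota v \in S by apply/SP.
pose f v : subalgebra clS := Sub (iota v) (Siota v).
have f_lin : linear f.
  move=> a u v; apply: (@val_inj _ _ (subalgebra clS)).
  by rewrite linearP/= linearP.
pose fM := GRing.isLinear.Build _ _ _ _ f f_lin.
pose fL : {linear V -> subalgebra clS} := HB.pack f fM.
case: clC => _ relC univ.
have relf : clifford_relation Q fL.
  by move=> v; apply: val_inj; rewrite rmorphM/= relC.
have [g [gE _]] := univ _ fL relf.
pose h y := val (g y).
have h_lin : linear h by move=> a y z; rewrite /h !linearP.
have h_mon : monoid_morphism h.
  by rewrite /h; split=> [|y z]; rewrite ?rmorph1 ?rmorphM.
pose hM : {lrmorphism C -> C} := HB.pack h
  (GRing.isLinear.Build _ _ _ _ h h_lin)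
  (GRing.isMonoidMorphism.Build _ _ h h_mon).
have <- : hM x = x by apply: clifford_endo_id => v; rewrite /= /h gE.
exact/SP/(valP (g x)).
Qed.

Lemma clifford_relationN : clifford_relation Q (fun v => - iota v).
Proof. by move=> v; rewrite mulrNN; case: clC => _ ->. Qed.

(** The extension of [- iota] to [C] is bijective because its square fixes every [iota v], hence is
    the identity. *)
Lemma clifford_alphaP :
  is_algebra_automorphism (clifford_alpha iota) /\
  forall v, clifford_alpha iota (iota v) = - iota v.
Proof.
apply: (@classical_sets.xgetPex _ (fun=> 0)
  (fun f => is_algebra_automorphism f /\ forall v, f (iota v) = - iota v)).
case: clC => _ _ /(_ C (-%R \o iota) clifford_relationN)[g [gE _]].
exists (g : C -> C); split=> //.
split; [exact: linearP| |exact: rmorph1|exact: rmorphM].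
have gK : cancel g g.
  apply: (@clifford_endo_id (g \o g)) => v.
  have gN : g (iota v) = - iota v := gE v.
  by rewrite /= gN raddfN /= gN opprK.
by exists g.
Qed.

(** An anti-endomorphism of [C] is a morphism from [C] to its opposite algebra, so [c] arises by
    extending [- iota] there. *)
Lemma clifford_conjP :
  is_algebra_antiautomorphism (clifford_conj iota) /\
  forall v, clifford_conj iota (iota v) = - iota v.
Proof.
apply: (@classical_sets.xgetPex _ (fun=> 0)
  (fun f => is_algebra_antiautomorphism f /\ forall v, f (iota v) = - iota v)).
pose f v : opposite C := - iota v.
have f_lin : linear f by move=> a u v; rewrite /f linearP opprD scalerN.
pose fL : {linear V -> opposite C} :=
  HB.pack f (GRing.isLinear.Build _ _ _ _ f f_lin).
have relf : clifford_relation Q fL by exact: clifford_relationN.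
case: clC => _ _ /(_ _ fL relf)[g [gE _]].
exists (g : C -> C).
have gM (x y : C) : (g (x * y) : C) = (g y : C) * (g x : C) by rewrite rmorphM.
have g_lin : linear (g : C -> C) by move=> a x y; exact: (linearP g a x y).
have gE1 v : (g (iota v) : C) = - iota v := gE v.
have g1 : (g 1 : C) = 1 by exact: (rmorph1 g).
(* As [g] lands in the opposite algebra, its square is not a composite of bundled morphisms of [C];
   induction on the elements replaces [clifford_endo_id]. *)
have gK : cancel (g : C -> C) (g : C -> C).
  apply: clifford_ind => [|v|a x y gx gy|x y gx gy].
  - by rewrite !g1.
  - by rewrite !gE1 -linearN gE1 linearN opprK.
  - by rewrite !g_lin gx gy.
  - by rewrite !gM gx gy.
split=> //; split=> //; by exists (g : C -> C).
Qed.

End UniversalProperty.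

(** * Monomials in an anticommuting family *)

Section AnticommutingFamily.
Variables (F : fieldType) (A : algType F) (T : finType).
Variables (e : T -> A) (q : T -> F).
Hypothesis charF : 2%:R != 0 :> F.
Hypothesis q_neq0 : forall k, q k != 0.
Hypothesis e_sqr : forall k, e k * e k = (q k)%:A.
Hypothesis e_anti : forall j k, j != k -> e j * e k = - (e k * e j).

Definition monomial (I : {set T}) : A := \prod_(i in I) e i.

(** The symmetric difference of [I] and [[set k]], which indexes the product of [e k] and
    [monomial I] up to a scalar. *)
Definition toggle (k : T) (I : {set T}) : {set T} :=
  [set i | (i \in I) (+) (i == k)].

Lemma monomial0 : monomial set0 = 1.
Proof. by rewrite /monomial big_set0. Qed.

(** Move [e k] to the right, one sign per factor passed, up to the position of [k]: there it is
    either inserted or merged with a second [e k] into [q k]. An arbitrary enumeration [s] makes the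
    induction possible. *)
Lemma gen_mul_prod (s : seq T) k (I : {set T}) : uniq s -> k \in s ->
  exists c : F, e k * \prod_(i <- s | i \in I) e i
                = c *: \prod_(i <- s | i \in toggle k I) e i.
Proof.
elim: s => [//|j s IHs] /= /andP[js us]; rewrite !big_cons !inE.
have [kj _|njk /= ks] := eqVneq k j; last first.
  have [c IHc] := IHs us ks.
  rewrite addbF; case: (j \in I); last by exists c.
  by exists (- c); rewrite mulrA e_anti // mulNr -mulrA IHc scaleNr -scalerAr.
rewrite -{}kj in js *.
have -> : \prod_(i <- s | i \in toggle k I) e i = \prod_(i <- s | i \in I) e i.
  rewrite big_seq_cond [RHS]big_seq_cond; apply: eq_bigl => i.
  by rewrite inE; case: eqP => [->|_]; rewrite ?(negPf js) ?addbF.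
rewrite addbT; case: (k \in I) => /=; last by exists 1; rewrite scale1r.
by exists (q k); rewrite mulrA e_sqr mulr_algl.
Qed.

Lemma gen_mul_monomial k I :
  exists c : F, e k * monomial I = c *: monomial (toggle k I).
Proof. exact: gen_mul_prod (index_enum_uniq T) (mem_index_enum k). Qed.

(** A factor [e k] commutes with itself, and each of the other factors contributes one sign. *)
Lemma gen_monomial_comm k I :
  e k * monomial I = (-1) ^+ #|I :\ k| * (monomial I * e k).
Proof.
have -> : #|I :\ k| = count [pred i | (i \in I) && (i != k)] (index_enum T).
  by rewrite -sum1_count -sum1_card; apply: eq_bigl => i; rewrite !inE andbC.
rewrite /monomial; elim: (index_enum T) => [|j s IHs] /=.
  by rewrite !big_nil mulr1 !mul1r.
rewrite big_cons; case: (j \in I) => //=.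
rewrite mulrA exprD; have [->|njk] := eqVneq j k.
  rewrite /= mul1r -mulrA [in LHS]IHs -signr_odd !mulr_sign.
  by case: odd; rewrite ?mulrN !mulrA.
rewrite e_anti 1?eq_sym //= expr1 mulN1r !mulNr -(mulrA (e j) (e k)) IHs.
congr (- _).
by rewrite -signr_odd !mulr_sign; case: odd; rewrite ?mulrN !mulrA.
Qed.

Lemma monomial_inv I : exists y, y * monomial I = 1 /\ monomial I * y = 1.
Proof.
rewrite /monomial; apply: (big_ind (fun x => exists y, y * x = 1 /\ x * y = 1)).
- by exists 1; rewrite !mul1r.
- move=> x1 x2 [y1 [y1x1 x1y1]] [y2 [y2x2 x2y2]]; exists (y2 * y1); split.
    by rewrite mulrA -(mulrA y2) y1x1 mulr1.
  by rewrite mulrA -(mulrA x1) x2y2 mulr1.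
move=> k _; exists ((q k)^-1 *: e k).
by rewrite -scalerAl -scalerAr e_sqr scalerA mulVf // scale1r.
Qed.

(** The numbers [#|I|] and [#|I :\ k|] differ by 1 exactly when [k] is in [I], so their parities
    determine [I]. *)
Lemma eq_set_parity (I J : {set T}) : odd #|I| = odd #|J| ->
  (forall k, odd #|I :\ k| = odd #|J :\ k|) -> I = J.
Proof.
move=> IJ IJk; apply/setP => k; move: IJ.
rewrite (cardsD1 k I) (cardsD1 k J) !oddD IJk => /addIb.
by case: (k \in I); case: (k \in J).
Qed.

(** * Independence of 1 and construction of the trace *)

Section Grading.
Variable alpha : {lrmorphism A -> A}.
Hypothesis alphaE : forall k, alpha (e k) = - e k.

Lemma alpha_monomial I : alpha (monomial I) = (-1) ^+ #|I| * monomial I.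
Proof.
rewrite /monomial -sum1_card.
apply: (big_ind3 (fun x n y => alpha x = (-1) ^+ n * y)) => //=.
- by rewrite rmorph1 mul1r.
- move=> x1 m x2 y1 n y2 h1 h2; rewrite rmorphM /= h1 h2 exprD.
  rewrite -(signr_odd _ m) -(signr_odd _ n) -!mulrA !mulr_sign.
  by case: (odd m); case: (odd n); rewrite ?mulrN ?mulNr ?mulrN ?opprK.
- by move=> k _; rewrite alphaE mulN1r.
Qed.

Let span x := exists a : {set T} -> F, x = \sum_I a I *: monomial I.

(** Taking [e k * x + x * e k] kills the terms anticommuting with [e k] and doubles the others, up
    to the invertible factor [e k]. *)
Lemma sum_even_monomial (a : {set T} -> F) (P : pred {set T}) k :
  \sum_(I | P I) a I *: monomial I = 0 ->
  \sum_(I | P I && ~~ odd #|I :\ k|) a I *: monomial I = 0.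
Proof.
set x := \sum_(I | P I) _ => x0; set y := \sum_(I | _) _.
have xy : e k * x + x * e k = 2%:R *: (y * e k).
  rewrite mulr_sumr !mulr_suml -big_split scaler_sumr big_mkcondr /=.
  apply: eq_bigr => I _; rewrite -scalerAr gen_monomial_comm.
  rewrite -signr_odd mulr_sign; case: odd => /=.
    by rewrite scalerN -scalerAl addNr.
  by rewrite -scalerAl scaler_nat mulr2n.
have : y * e k * e k = 0.
  move/eqP: xy; rewrite x0 mulr0 mul0r addr0 eq_sym scaler_eq0 (negPf charF) /=.
  by move/eqP->; rewrite mul0r.
rewrite -mulrA e_sqr -scalerAr mulr1 => /eqP.
by rewrite scaler_eq0 (negPf (q_neq0 k)) => /eqP.
Qed.

(* Keeping the terms commuting with every [e k] and fixed by [alpha] leaves only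
   the term of the empty set. *)
Lemma monomial_indep0 (a : {set T} -> F) :
  \sum_I a I *: monomial I = 0 -> a set0 = 0.
Proof.
move=> a0.
pose P (ks : seq T) (I : {set T}) := all (fun k => ~~ odd #|I :\ k|) ks.
have aP ks : \sum_(I | P ks I) a I *: monomial I = 0.
  elim: ks => [//|k ks IHs]; rewrite -[RHS](sum_even_monomial k IHs).
  by apply: eq_bigl => I; rewrite /P /= andbC.
set x := \sum_(I | P (enum T) I) a I *: monomial I.
have : x + alpha x = 2%:R *: (a set0)%:A.
  rewrite linear_sum -big_split (bigD1 set0) /=; last first.
    by apply/allP => k _; rewrite set0D cards0.
  rewrite linearZ /= monomial0 rmorph1 big1 => [|I /andP[/allP PI I0]].
    by rewrite addr0 scaler_nat mulr2n.
  rewrite linearZ /= alpha_monomial -signr_odd mulr_sign.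
  have [oI|oI] := boolP (odd #|I|); first by rewrite scalerN addrN.
  case/eqP: I0; apply: eq_set_parity; first by rewrite cards0 (negPf oI).
  move=> k; rewrite set0D cards0 /=; apply: negbTE; apply: PI.
  by rewrite mem_enum.
rewrite /x aP linear0 addr0 => /esym/eqP; rewrite !scaler_eq0 (negPf charF) /=.
by rewrite oner_eq0 orbF => /eqP.
Qed.

(** Computing the trace of [e k * x * e k] by cyclicity and by anticommutation gives [q k * tau x]
    and its opposite. *)
Lemma twisted_trace0 (tau : {scalar A}) k x :
  (forall x, tau (e k * x) = tau (x * e k)) ->
  e k * x = - (x * e k) -> tau x = 0.
Proof.
move=> tauC xk.
have : tau (e k * (x * e k)) = q k * tau x.
  by rewrite tauC -mulrA e_sqr -scalerAr mulr1 linearZ.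
rewrite mulrA xk mulNr -mulrA e_sqr -scalerAr mulr1 linearN linearZ /=.
move/eqP; rewrite -subr_eq0 -opprD oppr_eq0 -mulr2n -mulr_natl mulf_eq0.
by rewrite (negPf charF) mulf_eq0 (negPf (q_neq0 k)) => /eqP.
Qed.

Lemma odd_trace0 (tau : {scalar A}) x :
  (forall x, tau (alpha x) = tau x) -> alpha x = - x -> tau x = 0.
Proof.
move=> taua ax; have := taua x; rewrite ax linearN /= => /eqP.
rewrite -subr_eq0 -opprD oppr_eq0 -mulr2n -mulr_natl mulf_eq0.
by rewrite (negPf charF) => /eqP.
Qed.

(** Choose an expansion of each element. By [monomial_indep0], the coefficient at [set0] does not
    depend on the choice, and so is linear. *)
Lemma monomial_trace : (forall x, span x) ->
  exists tau : {scalar A}, forall I, tau (monomial I) = (I == set0)%:R.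
Proof.
move=> /choice[a aE]; pose tau x := a x set0.
have tauE b x : x = \sum_I b I *: monomial I -> tau x = b set0.
  move=> xE; apply/eqP; rewrite -subr_eq0; apply/eqP.
  apply: (@monomial_indep0 (fun I => a x I - b I)).
  under eq_bigr do rewrite scalerBl.
  by rewrite sumrB -aE -xE subrr.
have tau_lin : scalar tau.
  move=> c x y; apply: (tauE (fun I => c * a x I + a y I)).
  rewrite {1}(aE x) {1}(aE y) scaler_sumr -big_split.
  by apply: eq_bigr => I _; rewrite scalerDl scalerA.
pose tauL : {scalar A} :=
  HB.pack tau (GRing.isLinear.Build _ _ _ _ tau tau_lin).
exists tauL => I.
rewrite /= (tauE (fun J => (J == I)%:R)) 1?eq_sym //.
rewrite (bigD1 I) //= eqxx scale1r big1 ?addr0 // => J /negPf->.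
by rewrite scale0r.
Qed.

Lemma trace_exists : (forall x, span x) ->
  exists tau : {scalar A}, [/\ tau 1 = 1,
    forall x, tau (alpha x) = tau x &
    forall k x, tau (e k * x) = tau (x * e k)].
Proof.
move=> spanA; have [tau tauE] := monomial_trace spanA; exists tau; split.
- by rewrite -monomial0 tauE eqxx.
- move=> x; have [a ->] := spanA x; rewrite !linear_sum /=.
  apply: eq_bigr => I _; rewrite !linearZ /= alpha_monomial.
  rewrite -signr_odd mulr_sign; case: ifP => // oI; rewrite linearN /= tauE.
  by case: eqP oI => [->|]; rewrite ?cards0 // oppr0.
- move=> k x; have [a ->] := spanA x.
  rewrite mulr_sumr mulr_suml !linear_sum /=.
  apply: eq_bigr => I _; rewrite -scalerAr -scalerAl !linearZ /=; congr (_ * _).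
  have := gen_monomial_comm k I; rewrite -signr_odd mulr_sign.
  case: ifP => [oI kI|_ -> //]; have [c kIE] := gen_mul_monomial k I.
  (* In the anticommuting case the two traces are opposite, so both must vanish. This holds unless
     [toggle k I] is empty, which would make [I :\ k] empty although its cardinality is odd. *)
  suff t0 : tau (e k * monomial I) = 0.
    by apply/esym/eqP; rewrite t0 -oppr_eq0 -linearN -kI /= t0.
  rewrite kIE linearZ /= tauE; case: eqP => [tI0|_]; last exact: mulr0.
  suff Ik : I :\ k = set0 by rewrite Ik cards0 in oI.
  apply/setP => i; rewrite !inE; have := in_set0 i; rewrite -tI0 inE.
  by case: eqP; rewrite ?addbF.
Qed.

(** * Dual vectors and nondegeneracy of the trace form *)

Section Trace.
Variable tau : {scalar A}.
Hypothesis tau1 : tau 1 = 1.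
Hypothesis tau_alpha : forall x, tau (alpha x) = tau x.
Hypothesis tauC : forall k x, tau (e k * x) = tau (x * e k).

(* The dual vector is the inverse of [monomial I]: for [J != I] it makes
   [y * monomial J] anticommute with some [e k] or odd under [alpha]. *)
Lemma trace_dual I :
  exists y, y * monomial I = 1 /\ forall J, tau (y * monomial J) = (J == I)%:R.
Proof.
have [y [yI Iy]] := monomial_inv I; exists y; split=> // J.
(* The inverse [y] carries the same signs as [monomial I], both under [alpha] and, in [yk], under
   commutation with each [e k]. *)
have ya : alpha y = (-1) ^+ #|I| * y.
  rewrite -[LHS]mulr1 -[X in _ * X = _]Iy mulrA; congr (_ * y).
  have : alpha y * alpha (monomial I) = 1 by rewrite -rmorphM yI rmorph1.
  rewrite alpha_monomial => ayI; rewrite -[RHS]mulr1 -[X in _ = _ * X]ayI.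
  by rewrite -signr_odd !mulr_sign; case: odd; rewrite ?mulrN ?opprK.
have yk k : e k * y = (-1) ^+ #|I :\ k| * (y * e k).
  rewrite -[LHS]mul1r -{1}yI -!mulrA (mulrA (monomial I)).
  have := gen_monomial_comm k I; rewrite -signr_odd !mulr_sign.
  case: ifP => _ => [/eqP|<-]; last by rewrite -mulrA Iy mulr1.
  by rewrite -eqr_oppLR => /eqP <-; rewrite mulNr -mulrA Iy mulr1 mulrN.
have [->|JI] := eqVneq J I; first by rewrite yI.
have [oJI|/negPn/eqP oJI] := boolP (odd #|J| != odd #|I|).
  apply: odd_trace0 => //; rewrite rmorphM /= ya alpha_monomial.
  rewrite -signr_odd -(signr_odd _ #|J|) !mulr_sign.
  by case: (odd #|I|) (odd #|J|) oJI => -[] //; rewrite ?mulrN ?mulNr.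
have [k oJIk] : exists k, odd #|J :\ k| != odd #|I :\ k|.
  apply/existsP; apply: contraNT JI; rewrite negb_exists => /forallP oJIk.
  by apply/eqP/eq_set_parity => // k; apply/eqP/negbNE.
apply: (@twisted_trace0 _ k) => //.
rewrite mulrA yk -!mulrA gen_monomial_comm.
rewrite -signr_odd -(signr_odd _ #|J :\ k|) !mulr_sign.
by case: (odd #|I :\ k|) (odd #|J :\ k|) oJIk => -[] //; rewrite mulrN.
Qed.

Lemma trace_coef0 (a : {set T} -> F) : tau (\sum_I a I *: monomial I) = a set0.
Proof.
have [y []] := trace_dual set0; rewrite monomial0 mulr1 => -> yE.
rewrite linear_sum (bigD1 set0) //= linearZ /= monomial0 tau1 mulr1.
rewrite big1 ?addr0 // => I /negPf I0.
by rewrite linearZ /= -[monomial I]mul1r yE I0 mulr0.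
Qed.

(** Pairing with the dual vector of [monomial I] isolates the coefficient [a I]. *)
Lemma trace_nondegenerate x : span x -> (forall y, tau (y * x) = 0) -> x = 0.
Proof.
move=> [a ->] x0; rewrite big1 // => I _; have [y [_ yE]] := trace_dual I.
have := x0 y; rewrite mulr_sumr linear_sum (bigD1 I) //=.
rewrite -scalerAr linearZ /= yE.
rewrite eqxx mulr1 big1 => [|J /negPf JI]; last first.
  by rewrite -scalerAr linearZ /= yE JI mulr0.
by rewrite addr0 => ->; rewrite scale0r.
Qed.

End Trace.
End Grading.
End AnticommutingFamily.

(** * Orthogonal bases of symmetric forms *)

Section OrthogonalBasis.
Variables (F : fieldType) (V : vectType F) (Q : {symmetric V}).
Hypothesis charF : 2%:R != 0 :> F.

Lemma symmC u v : Q u v = Q v u.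
Proof. by rewrite hermC expr0 mul1r. Qed.

(** Polarization: on [U], [Q (u + v) (u + v)] reduces to twice [Q u v]. *)
Lemma isotropic_form0 (U : {vspace V}) :
  {in U, forall u, Q u u = 0} -> {in U &, forall u v, Q u v = 0}.
Proof.
move=> U0 u v Uu Uv; have := U0 (u + v) (memvD Uu Uv).
rewrite hnormD /= !U0 // !add0r expr0 mul1r -mulr2n -mulr_natl => /eqP.
by rewrite mulf_eq0 (negPf charF) => /eqP.
Qed.

Lemma pair_ortho_recP (s : seq V) :
  (forall i j, (i < j < size s)%N -> Q s`_i s`_j = 0) -> pair_ortho_rec Q s.
Proof.
elim: s => //= u s IHs us; rewrite andbT IHs ?andbT => [|i j ij]; last first.
  exact: (us i.+1 j.+1).
apply/allP => v /(nthP 0)[j js <-] /=; apply/eqP.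
exact: (us 0%N j.+1).
Qed.

(** Induction on the dimension: split off the line of a vector [u] with [Q u u != 0]; if there is
    none, the form vanishes on [U] and any basis works. *)
Lemma exists_orthogonal_seq (U : {vspace V}) :
  exists s, basis_of U s /\ pair_ortho_rec Q s.
Proof.
have [m] := ubnP (\dim U); elim: m U => // m IHm U; rewrite ltnS => dimU.
have [[u Uu Quu]|U0] := pselect (exists2 u, u \in U & Q u u != 0); last first.
  have Q0 : {in U &, forall u v, Q u v = 0}.
    apply: isotropic_form0 => u Uu; apply/eqP/negPn/negP => Quu.
    by apply: U0; exists u.
  exists (vbasis U); split; first exact: vbasisP.
  apply: pair_ortho_recP => i j /andP[ij js].
  by apply: Q0; apply: vbasis_mem; apply: mem_nth => //; apply: ltn_trans js.
pose W := (U :&: orthov Q <[u]>)%VS.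
have UW : (<[u]> + W)%VS = U.
  apply/eqP; rewrite eqEsubv subv_add -memvE Uu capvSl /=.
  (* [b *: u] is the orthogonal projection of [v] on the line of [u]. *)
  apply/subvP => v Uv; pose b := Q v u / Q u u.
  have -> : v = b *: u + (v - b *: u).
    by rewrite addrC subrK.
  apply: memv_add; first by rewrite memvZ ?memv_line.
  rewrite memv_cap memvB ?memvZ //= mem_orthov1 linearBl linearZl_LR /=.
  by rewrite /b divfK // subrr.
have uW : u \notin W by rewrite memv_cap Uu mem_orthov1.
have u0 : u != 0 by apply: contraNneq uW => ->; rewrite mem0v.
have uW0 : (<[u]> :&: W)%VS = 0%VS.
  apply/eqP; rewrite -subv0; apply/subvP => v.
  rewrite memv_cap => /andP[/vlineP[a ->]].
  have [->|a0] := eqVneq a 0; first by rewrite scale0r !mem0v.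
  by move/(memvZ a^-1); rewrite scalerA mulVf // scale1r (negPf uW).
have dimW : (\dim W < m)%N.
  apply: leq_trans dimU; rewrite -UW dimv_disjoint_sum // dim_vline u0.
  exact: leqnn.
have [s [/andP[/eqP sW fs] os]] := IHm W dimW.
exists (u :: s); split.
  by rewrite /basis_of span_cons sW UW eqxx free_cons sW uW.
rewrite /= os !andbT; apply/allP => v sv /=.
have : v \in W by rewrite -sW memv_span.
by rewrite memv_cap mem_orthov1 herm_eq0C => /andP[].
Qed.

Lemma exists_orthogonal_basis : exists e, orthogonal_basis Q e.
Proof.
have [s [bs os]] := exists_orthogonal_seq fullv.
have sz : size s == \dim {:V} by case/andP: (bs) => /eqP <-; rewrite eq_sym.
exists (Tuple sz); rewrite /orthogonal_basis bs /pairwise_orthogonal os andbT.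
apply/negP => s0; have := basis_free bs.
by move/free_not0/(_ s0); rewrite eqxx.
Qed.

Hypothesis ndQ : nondegenerate Q.
Variable e : (\dim {:V}).-tuple V.
Hypothesis oe : orthogonal_basis Q e.

Lemma orthogonal_basis0 i j : i != j -> Q (tnth e i) (tnth e j) = 0.
Proof.
have rec0 (s : seq V) k l : pair_ortho_rec Q s -> (k < l < size s)%N ->
    Q s`_k s`_l = 0.
  elim: s k l => [|u s IHs] [|k] [|l] //=;
    rewrite ?ltnS ?andbF // => /andP[us os] kl.
    by move: us; rewrite andbT => /allP/(_ _ (mem_nth 0 kl))/eqP.
  exact: IHs.
have [_ /andP[_ oQ]] := andP oe.
wlog ij : i j / (i < j)%N => [hw ne|_].
  case: (ltngtP i j) => [ij|ij|/val_inj ij]; first exact: hw.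
    by rewrite symmC; apply: hw; rewrite 1?eq_sym.
  by rewrite ij eqxx in ne.
by rewrite !(tnth_nth 0); apply: rec0; rewrite // ij size_tuple ltn_ord.
Qed.

(** A basis vector orthogonal to itself would be orthogonal to the whole basis, hence lie in the
    radical and be 0. *)
Lemma orthogonal_basis_neq0 i : Q (tnth e i) (tnth e i) != 0.
Proof.
have [be /andP[e0 _]] := andP oe.
apply: contra e0 => /eqP Qii; suff <- : tnth e i = 0 by apply: mem_tnth.
apply/eqP; rewrite -memv0 -(eqP ndQ); apply/mem_orthovP => v _.
rewrite (coord_basis be (memvf v)) linear_sumr big1 // => j _.
rewrite linearZr /= -tnth_nth; have [ij|ij] := eqVneq i j.
  by rewrite -ij Qii mulr0.
by rewrite orthogonal_basis0 ?mulr0.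
Qed.

End OrthogonalBasis.

(** * The trace of the Clifford algebra and its scalar part *)

Section CliffordTrace.
Variables (F : fieldType) (V : vectType F) (Q : {symmetric V}).
Variables (C : algType F) (iota : {linear V -> C}).
Hypothesis charF : 2%:R != 0 :> F.
Hypothesis ndQ : nondegenerate Q.
Hypothesis clC : is_clifford_algebra Q iota.

Local Notation alpha := (clifford_alpha iota).
Local Notation c := (clifford_conj iota).

(** Polarization of the defining relation at [u + v]. *)
Lemma clifford_anticomm u v :
  iota u * iota v + iota v * iota u = - (2%:R * Q u v)%:A.
Proof.
case: clC => _ rel _; have := rel (u + v).
rewrite linearD mulrDl !mulrDr !rel hnormD /= expr0 mul1r !scalerDl !opprD.
rewrite mulr_natl mulr2n scalerDl opprD.
move/(congr1 (fun x => (Q u u)%:A + x + (Q v v)%:A)).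
by rewrite !addrA subrr !add0r subrK => ->; rewrite -!addrA addrC !addrA addrK.
Qed.

Section Basis.
Variable e : (\dim {:V}).-tuple V.
Hypothesis oe : orthogonal_basis Q e.
Let f i := iota (tnth e i).
Let q i := - Q (tnth e i) (tnth e i).

Let q_neq0 i : q i != 0.
Proof. by rewrite oppr_eq0 (orthogonal_basis_neq0 ndQ oe). Qed.

Let f_sqr i : f i * f i = (q i)%:A.
Proof. by case: clC => _ -> _; rewrite scaleNr. Qed.

Let f_anti i j : i != j -> f i * f j = - (f j * f i).
Proof.
move=> ij; apply/eqP; rewrite -addr_eq0 clifford_anticomm.
by rewrite (orthogonal_basis0 oe ij) mulr0 scale0r oppr0.
Qed.

Lemma gen_basis v : exists b, v = \sum_i b i *: tnth e i.
Proof.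
have [be _] := andP oe; exists (fun i => coord e i v).
rewrite [LHS](coord_basis be (memvf v)).
by apply: eq_bigr => i _; rewrite (tnth_nth 0).
Qed.

Lemma basis_product_span x :
  exists a : {set 'I_(\dim {:V})} -> F,
    x = \sum_I a I *: basis_product iota e I.
Proof.
pose S z :=
  exists a : {set 'I_(\dim {:V})} -> F, z = \sum_I a I *: monomial f I.
have Slin (b : F) y z : S y -> S z -> S (b *: y + z).
  move=> [a1 ->] [a2 ->]; exists (fun I => b * a1 I + a2 I).
  rewrite scaler_sumr -big_split; apply: eq_bigr => I _.
  by rewrite scalerDl scalerA.
have S0 : S 0.
  by exists (fun=> 0); rewrite big1 // => I _; rewrite scale0r.
have Smon I : S (monomial f I).
  exists (fun J => (J == I)%:R).
  rewrite (bigD1 I) //= eqxx scale1r big1 ?addr0 // => J /negPf->.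
  by rewrite scale0r.
have Ssum (J : finType) (b : J -> F) (z : J -> C) :
    (forall i, S (z i)) -> S (\sum_i b i *: z i).
  move=> Sz; apply: (big_ind S) => // [y1 y2 Sy1 Sy2|i _].
    by rewrite -[y1]scale1r; apply: Slin.
  by rewrite -[_ *: _]addr0; apply: Slin.
(* Stability of the span under left multiplication is suited to induction on [x]: a product acts by
   two successive multiplications. Applied to 1, it puts [x] in the span. *)
suff SM : forall z, S z -> S (x * z).
  by rewrite -[x]mulr1 -(monomial0 f); apply: SM.
elim/(clifford_ind clC): x => [|v|b x y Sx Sy|x y Sx Sy] z Sz.
- by rewrite mul1r.
- have [b ->] := gen_basis v; have [a ->] := Sz.
  rewrite linear_sum mulr_suml.
  under eq_bigr do rewrite linearZ -scalerAl.
  apply: (Ssum) => i; rewrite mulr_sumr; under eq_bigr do rewrite -scalerAr.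
  apply: (Ssum) => I; have [d ->] := gen_mul_monomial f_sqr f_anti i I.
  by rewrite -[_ *: _]addr0; apply: Slin.
- by rewrite mulrDl -scalerAl; apply: Slin; [apply: Sx|apply: Sy].
- by rewrite -mulrA; apply/Sx/Sy.
Qed.

(** Commutation under the trace is known for the generators [f i]; it extends to vectors by
    linearity and to products by moving one factor at a time. *)
Lemma clifford_trace_exists (g : {lrmorphism C -> C}) :
  (forall v, g (iota v) = - iota v) ->
  exists tau : {scalar C}, [/\ tau 1 = 1, forall x, tau (g x) = tau x &
    forall x y, tau (x * y) = tau (y * x)].
Proof.
move=> gE; have gf i : g (f i) = - f i by exact: gE.
have [tau [tau1 taug tauf]] :=
  trace_exists charF q_neq0 f_sqr f_anti gf basis_product_span.
exists tau; split=> //; elim/(clifford_ind clC) => [|v|b x y hx hy|x y hx hy] z.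
- by rewrite mulr1 mul1r.
- have [b ->] := gen_basis v.
  rewrite linear_sum mulr_suml mulr_sumr !linear_sum.
  apply: eq_bigr => i _.
  by rewrite linearZ /= -scalerAl -scalerAr !linearZ /= tauf.
- by rewrite mulrDl mulrDr -scalerAl -scalerAr !linearP /= hx hy.
- by rewrite -mulrA hx -mulrA hy mulrA.
Qed.

Section BasisTrace.
Variables (g : {lrmorphism C -> C}) (tau : {scalar C}).
Hypothesis gE : forall v, g (iota v) = - iota v.
Hypothesis tau1 : tau 1 = 1.
Hypothesis taug : forall x, tau (g x) = tau x.
Hypothesis tauC : forall x y, tau (x * y) = tau (y * x).

Let gf i : g (f i) = - f i. Proof. exact: gE. Qed.

Lemma clifford_trace_coef0 (a : {set 'I_(\dim {:V})} -> F) :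
  tau (\sum_I a I *: basis_product iota e I) = a set0.
Proof. by apply: (trace_coef0 charF q_neq0 f_sqr f_anti gf). Qed.

Lemma clifford_trace_nondegenerate x : (forall y, tau (y * x) = 0) -> x = 0.
Proof.
move=> x0; apply: (trace_nondegenerate charF q_neq0 f_sqr f_anti gf tau1) => //.
exact: basis_product_span.
Qed.

End BasisTrace.
End Basis.

(** The map selected by [xget] is a bare function, whereas the results on traces take a bundled
    morphism. *)
Lemma clifford_alpha_lrmorphism :
  exists g : {lrmorphism C -> C}, alpha =1 g.
Proof.
have [[lin _ a1 aM] _] := clifford_alphaP clC.
have mon : monoid_morphism alpha by split.
by exists (HB.pack alpha (GRing.isLinear.Build _ _ _ _ alpha lin)
  (GRing.isMonoidMorphism.Build _ _ alpha mon) : {lrmorphism C -> C}).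
Qed.

Lemma clifford_conjK : involutive c.
Proof.
have [[lin _ c1 cM] cE] := clifford_conjP clC.
elim/(clifford_ind clC) => [|v|b x y hx hy|x y hx hy].
- by rewrite !c1.
- by rewrite cE -linearN cE linearN opprK.
- by rewrite !lin hx hy.
- by rewrite !cM hx hy.
Qed.

Lemma clifford_conj_alpha x : c (alpha x) = alpha (c x).
Proof.
have [[lin _ c1 cM] cE] := clifford_conjP clC.
have [[alin _ a1 aM] aE] := clifford_alphaP clC.
elim/(clifford_ind clC): x => [|v|b x y hx hy|x y hx hy].
- by rewrite a1 c1 a1.
- by rewrite aE cE -linearN cE aE.
- by rewrite !lin !alin lin hx hy.
- by rewrite !aM !cM aM hx hy.
Qed.

Definition is_clifford_trace (tau : C -> F) :=
  [/\ tau 1 = 1, forall x, tau (alpha x) = tau x &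
      forall x y, tau (x * y) = tau (y * x)].

(** Every expansion in every orthogonal basis has [tau x] as its coefficient of 1. This gives
    independence of the basis and also uniqueness of [tau]. *)
Lemma scalar_partE (tau : {scalar C}) :
  is_clifford_trace tau -> scalar_part Q iota =1 tau.
Proof.
move=> [tau1 taua tauC] x.
have [g gE] := clifford_alpha_lrmorphism.
have gN v : g (iota v) = - iota v by rewrite -gE; case: (clifford_alphaP clC).
have taug y : tau (g y) = tau y by rewrite -gE.
have coef0 e (oe : orthogonal_basis Q e) :=
  clifford_trace_coef0 oe gN tau1 taug tauC.
have [e oe] := exists_orthogonal_basis Q charF.
apply: classical_sets.xget_unique => [|t [e' [a [oe' -> ->]]]].
  have [a xE] := basis_product_span oe x.
  by exists e, a; split=> //; rewrite {1}xE coef0.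
by rewrite coef0.
Qed.

Lemma scalar_part_trace : exists tau : {scalar C},
  is_clifford_trace tau /\ scalar_part Q iota =1 tau.
Proof.
have [g gE] := clifford_alpha_lrmorphism.
have [e oe] := exists_orthogonal_basis Q charF.
have gN v : g (iota v) = - iota v by rewrite -gE; case: (clifford_alphaP clC).
have [tau [tau1 taug tauC]] := clifford_trace_exists oe gN.
have ttau : is_clifford_trace tau by split=> // x; rewrite gE.
by exists tau; split=> //; apply: scalar_partE.
Qed.

(** The form [tau \o c] is again a normalized trace, so both forms equal the scalar part. *)
Lemma trace_conj (tau : {scalar C}) : is_clifford_trace tau ->
  forall x, tau (c x) = tau x.
Proof.
move=> ttau x; have [tau1 taua tauC] := ttau.
have [[lin _ c1 cM] _] := clifford_conjP clC.
have tc_lin : scalar (tau \o c) by move=> b y z; rewrite /= lin linearP.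
pose tc : {scalar C} :=
  HB.pack (tau \o c) (GRing.isLinear.Build _ _ _ _ _ tc_lin).
have ttc : is_clifford_trace tc.
  split=> [|y|y z] /=; first by rewrite c1.
    by rewrite clifford_conj_alpha taua.
  by rewrite !cM tauC.
by rewrite -[RHS](scalar_partE ttau) (scalar_partE ttc).
Qed.

Lemma trace_nondegenerate_right (tau : {scalar C}) x : is_clifford_trace tau ->
  (forall y, tau (y * x) = 0) -> x = 0.
Proof.
move=> [tau1 taua tauC].
have [g gE] := clifford_alpha_lrmorphism.
have [e oe] := exists_orthogonal_basis Q charF.
apply: (clifford_trace_nondegenerate oe (g := g)) => // [v|y].
  by rewrite -gE; case: (clifford_alphaP clC).
by rewrite -gE.
Qed.

Lemma Qbar_nondegenerate z z' :
  (forall y, Qbar Q iota y z = Qbar Q iota y z') -> z = z'.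
Proof.
have [tau [ttau spE]] := scalar_part_trace => zz'.
(* Since [Qbar] pairs [y] with [c z], the trace form shows [c z = c z'], and [c] is injective. *)
rewrite -[z]clifford_conjK -[z']clifford_conjK; congr c; apply/eqP.
rewrite -subr_eq0; apply/eqP/(trace_nondegenerate_right ttau) => y.
by rewrite mulrBr linearB /= -!spE [X in X - _]zz' subrr.
Qed.

Lemma metric_adjointE (S T : C -> C) : linear S ->
  (forall y z, Qbar Q iota (T y) z = Qbar Q iota y (S z)) ->
  metric_adjoint (Qbar Q iota) T = S.
Proof.
move=> S_lin TS; apply: classical_sets.xget_unique => // S' [_ TS'].
by apply/funext => z; apply: Qbar_nondegenerate => y; rewrite -TS -TS'.
Qed.

End CliffordTrace.

(** * The six identities as trace manipulations *)

Theorem proposition4p1 (F : fieldType) (charF : 2%N \notin [pchar F])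
    (V : vectType F) (Q : {symmetric V}) (ndQ : nondegenerate Q)
    (C : algType F) (iota : {linear V -> C})
    (clC : is_clifford_algebra Q iota) :
  Qbar Q iota 1 1 = 1 /\
  (forall x : C, metric_adjoint (Qbar Q iota) (Lmul x)
                 = Lmul (clifford_conj iota x)) /\
  (forall x : C, metric_adjoint (Qbar Q iota) (Rmul x)
                 = Rmul (clifford_conj iota x)) /\
  (forall u v : V, Qbar Q iota (iota u) (iota v) = Q u v) /\
  (forall x y : C, Qbar Q iota (clifford_alpha iota x) (clifford_alpha iota y)
                   = Qbar Q iota x y) /\
  (forall x y : C, Qbar Q iota (clifford_conj iota x) (clifford_conj iota y)
                   = Qbar Q iota x y).
Proof.
have char2 : 2%:R != 0 :> F by move: charF; rewrite inE /=.
have [[c_lin _ c1 cM] cE] := clifford_conjP clC.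
have [[_ _ _ aM] _] := clifford_alphaP clC.
have cK := clifford_conjK clC.
have [tau [ttau spE]] := scalar_part_trace char2 ndQ clC.
have [tau1 taua tauC] := ttau.
have QbarE x y : Qbar Q iota x y = tau (x * clifford_conj iota y) by exact: spE.
split; first by rewrite QbarE c1 mul1r.
split=> [x|].
  apply: (metric_adjointE char2 ndQ clC) => [b y z|y z].
    by rewrite /Lmul mulrDr -scalerAr.
  (* Here [c (c x * z)] is [c z * x], and cyclicity brings [x] back to the front. *)
  by rewrite !QbarE /Lmul cM cK -mulrA tauC mulrA.
split=> [x|].
  apply: (metric_adjointE char2 ndQ clC) => [b y z|y z].
    by rewrite /Rmul mulrDl -scalerAl.
  by rewrite !QbarE /Rmul cM cK mulrA.
split=> [u v|].
  rewrite QbarE cE mulrN linearN /=.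
  (* By cyclicity the anticommutator of [iota u] and [iota v] has trace twice that of their product;
     cancelling 2 leaves [- Q u v]. *)
  have := congr1 tau (clifford_anticomm clC u v).
  rewrite linearD linearN linearZ /= tau1 mulr1 [X in _ + X]tauC -[_ + _]mulr2n.
  rewrite -[_ *+ 2]mulr_natl => /eqP.
  rewrite -mulrN (inj_eq (mulfI char2)) => /eqP->.
  by rewrite opprK.
split=> x y; rewrite !QbarE.
  by rewrite (clifford_conj_alpha clC) -aM taua.
(* The product [c x * c (c y)] is [c (c y * x)], whose trace is that of [c y * x]. *)
by rewrite -cM (trace_conj char2 ndQ clC ttau) tauC.
Qed.
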